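(* A Fedosov manifold $(M,\omega,\nabla)$ admitting a homogeneous structure tensor $S$ of linear type does not admit any pseudo-Riemannian metric $g$ such that $S\cdot g=0$.
   Context: A Fedosov manifold $(M,\omega,\nabla)$ is a symplectic manifold $(M,\omega)$ with a torsion-free linear connection $\nabla$ such that $\nabla\omega=0$. A homogeneous structure tensor is a $(1,2)$-tensor field $S$ such that, for $\tilde\nabla=\nabla-S$, one has $\tilde\nabla R=0$, $\tilde\nabla S=0$, $\tilde\nabla\omega=0$, where $R$ is the curvature of $\nabla$. It is of linear type if $S_XY=\omega(X,Y)\xi-\omega(Y,\xi)X$ for a vector field $\xi$ on $M$. The condition $S\cdot g=0$ means $g(S_XY,Z)+g(Y,S_XZ)=0$ for all $X,Y,Z$.
   Formalization: The formal statement assumes in addition that S is not identically zero; for S = 0 (ξ = 0), for example on flat R^{2n}, every metric g satisfies S·g = 0 and the claim as worded fails. *)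

(* Defs.v *)
From HB Require Import structures.
From mathcomp Require Import all_boot all_order all_algebra.
From mathcomp Require Import sesquilinear.
From mathcomp Require Import boolp classical_sets functions reals.
From mathcomp Require Import topology normedtype derive.
From mathcomp Require Import ring.

Set Implicit Arguments.
Unset Strict Implicit.
Unset Printing Implicit Defensive.
Import Order.TTheory GRing.Theory Num.Theory.
Import numFieldNormedType.Exports.
Local Open Scope classical_set_scope.
Local Open Scope ring_scope.

Section SmoothOn.
Context {R : realType} {d : nat} {W : normedModType R}.
Implicit Types (U : set 'rV[R]_d) (f : 'rV[R]_d -> W).

(* All iterated partial derivatives of order at most k exist and are
   continuous at every point of U; meant for open U. *)
Fixpoint Ck_on (k : nat) U f : Prop :=
  (forall x, U x -> {for x, continuous f}) /\
  if k is k'.+1 then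
    forall i : 'I_d,
      (forall x, U x -> derivable f x (delta_mx 0 i)) /\
      Ck_on k' U ('D_(delta_mx 0 i) f)
  else True.

Definition smooth_on U f := forall k, Ck_on k U f.

End SmoothOn.

Section SmoothOnTheory.
Context {R : realType} {d : nat}.
Implicit Types (U : set 'rV[R]_d) (f g : 'rV[R]_d -> R).

Lemma eq_Ck_on k U f g : open U ->
  (forall x, U x -> f x = g x) -> Ck_on k U f -> Ck_on k U g.
Proof.
move=> oU.
have nE h1 h2 : (forall x, U x -> h1 x = h2 x) ->
    forall x : 'rV[R]_d, U x -> {near x, h1 =1 h2}.
  move=> h12 x Ux.
  have := open_nbhs_nbhs (conj oU Ux : open_nbhs x U).
  by apply: filterS => y /h12.
have cE h1 h2 : (forall x, U x -> h1 x = h2 x) ->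
    (forall x, U x -> {for x, continuous h1}) ->
    forall x, U x -> {for x, continuous (h2 : 'rV[R]_d -> R)}.
  move=> h12 ch1 x Ux; rewrite /prop_for /continuous_at -(h12 x Ux).
  apply: cvg_trans (ch1 x Ux); apply: (@near_eq_cvg _ _ (nbhs x)).
  exact: nE.
elim: k f g => [|k IHk] f g fg [cf df]; split => //; try exact: cE cf.
move=> i; have [dfi Cfi] := df i; split.
- by move=> x Ux; apply: near_eq_derivable (dfi x Ux); exact: nE.
- by apply: IHk Cfi => x Ux; apply: near_eq_derive; exact: nE.
Qed.

Lemma Ck_onS k U f : Ck_on k.+1 U f -> Ck_on k U f.
Proof.
elim: k f => [|k IHk] f [cf df]; split=> // i.
by have [dfi Cfi] := df i; split=> //; exact: IHk.
Qed.

Lemma Ck_on_cst k U (a : R) : Ck_on k U (cst a).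
Proof.
elim: k a => [|k IHk] a; split=> //; try by move=> x _; exact: cst_continuous.
move=> i; split; first by move=> x _; exact: derivable_cst.
have -> : 'D_(delta_mx 0 i) (cst a) = cst 0 :> ('rV[R]_d -> R).
  by apply/funext => x; exact: derive_cst.
exact: IHk.
Qed.

Lemma Ck_onB k U f g : open U ->
  Ck_on k U f -> Ck_on k U g -> Ck_on k U (f - g).
Proof.
move=> oU; elim: k f g => [|k IHk] f g [cf df] [cg dg]; split=> //;
  try by move=> x Ux; apply: continuousB; [exact: cf | exact: cg].
move=> i; have [dfi Cfi] := df i; have [dgi Cgi] := dg i; split.
  by move=> x Ux; apply: derivableB; [exact: dfi | exact: dgi].
apply: eq_Ck_on (IHk _ _ Cfi Cgi) => // x Ux.
by rewrite deriveB//; [exact: dfi | exact: dgi].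
Qed.

Lemma Ck_onD k U f g : open U ->
  Ck_on k U f -> Ck_on k U g -> Ck_on k U (f + g).
Proof.
move=> oU Cf Cg; rewrite -[g]opprK; apply: Ck_onB => //.
by rewrite -[- g]sub0r; apply: Ck_onB => //; exact: Ck_on_cst.
Qed.

Lemma Ck_onM k U f g : open U ->
  Ck_on k U f -> Ck_on k U g -> Ck_on k U (f * g).
Proof.
move=> oU; elim: k f g => [|k IHk] f g Cf Cg;
  move: (Cf) (Cg) => [cf df] [cg dg]; split=> //;
  try by move=> x Ux; apply: continuousM; [exact: cf | exact: cg].
move=> i; have [dfi Cfi] := df i; have [dgi Cgi] := dg i; split.
  by move=> x Ux; apply: derivableM; [exact: dfi | exact: dgi].
have Cfg := Ck_onD oU (IHk _ _ (Ck_onS Cf) Cgi) (IHk _ _ (Ck_onS Cg) Cfi).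
apply: eq_Ck_on Cfg => // x Ux.
by rewrite deriveM//; [exact: dfi | exact: dgi].
Qed.

End SmoothOnTheory.

Section Manifold.
Context {R : realType} {d : nat}.

(* A homeomorphism from an open subset of M onto an open subset of R^d. The
   two underlying functions are total; only their values on [chart_dom] and
   [chart_img] matter. *)
Record chart (M : topologicalType) := Chart {
  chart_dom : set M ;
  chart_img : set 'rV[R]_d ;
  chart_map : M -> 'rV[R]_d ;
  chart_inv : 'rV[R]_d -> M ;
  open_chart_dom : open chart_dom ;
  open_chart_img : open chart_img ;
  chart_map_img : forall p, chart_dom p -> chart_img (chart_map p) ;
  chart_inv_dom : forall x, chart_img x -> chart_dom (chart_inv x) ;
  chart_mapK : forall p, chart_dom p -> chart_inv (chart_map p) = p ;
  chart_invK : forall x, chart_img x -> chart_map (chart_inv x) = x ;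
  chart_map_continuous :
    forall p, chart_dom p -> {for p, continuous chart_map} ;
  chart_inv_continuous :
    forall x, chart_img x -> {for x, continuous chart_inv} }.

Definition smooth_transition (M : topologicalType) (c c' : chart M) :=
  smooth_on (chart_img c `&` chart_inv c @^-1` chart_dom c')
            (chart_map c' \o chart_inv c).

End Manifold.

Arguments chart R d M : clear implicits.

(* The atlas need not be maximal; smoothness does not depend on that. *)
Record manifold (R : realType) (d : nat) := Manifold {
  manifold_space :> topologicalType ;
  manifold_hausdorff : hausdorff_space manifold_space ;
  manifold_second_countable : @second_countable manifold_space ;
  atlas : set (chart R d manifold_space) ;
  atlas_cover : forall p, exists2 c, atlas c & chart_dom c p ;
  atlas_compatible : forall c c', atlas c -> atlas c' -> smooth_transition c c'
}.

Section SmoothFunctions.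
Context {R : realType} {d : nat} (M : manifold R d).

Definition smooth (f : M -> R) : Prop :=
  forall c, atlas c -> smooth_on (chart_img c) (f \o chart_inv c).

Definition smooth_pred : {pred M -> R} := mem [set f | smooth f].

Record smoothfun := SmoothFun_ {
  smoothfun_val :> M -> R ;
  smoothfun_subproof : smooth_pred smoothfun_val }.

HB.instance Definition _ := [isSub for smoothfun_val].
HB.instance Definition _ := [Choice of smoothfun by <:].

Lemma smooth_cst (a : R) : smooth (cst a).
Proof. by move=> c _ k; exact: Ck_on_cst. Qed.

Lemma smoothB (f g : M -> R) : smooth f -> smooth g -> smooth (f - g).
Proof.
move=> sf sg c Ac k.
have -> : (f - g) \o chart_inv c = (f \o chart_inv c) - (g \o chart_inv c).
  by [].
exact: Ck_onB (@open_chart_img _ _ _ c) (sf c Ac k) (sg c Ac k).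
Qed.

Lemma smoothD (f g : M -> R) : smooth f -> smooth g -> smooth (f + g).
Proof.
move=> sf sg c Ac k.
have -> : (f + g) \o chart_inv c = (f \o chart_inv c) + (g \o chart_inv c).
  by [].
exact: Ck_onD (@open_chart_img _ _ _ c) (sf c Ac k) (sg c Ac k).
Qed.

Lemma smoothM (f g : M -> R) : smooth f -> smooth g -> smooth (f * g).
Proof.
move=> sf sg c Ac k.
have -> : (f * g) \o chart_inv c = (f \o chart_inv c) * (g \o chart_inv c).
  by [].
exact: Ck_onM (@open_chart_img _ _ _ c) (sf c Ac k) (sg c Ac k).
Qed.

Lemma smooth_subring_closed : subring_closed smooth_pred.
Proof.
split; first by apply/mem_set; exact: smooth_cst.
- by move=> f g /set_mem sf /set_mem sg; apply/mem_set; exact: smoothB.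
- by move=> f g /set_mem sf /set_mem sg; apply/mem_set; exact: smoothM.
Qed.

HB.instance Definition _ :=
  GRing.isSubringClosed.Build (M -> R) smooth_pred smooth_subring_closed.

Lemma smooth_scaler_closed : GRing.scaler_closed smooth_pred.
Proof.
move=> a f /set_mem sf; apply/mem_set.
exact: (smoothM (smooth_cst a) sf).
Qed.

HB.instance Definition _ :=
  GRing.isScaleClosed.Build R (M -> R) smooth_pred smooth_scaler_closed.

HB.instance Definition _ := GRing.SubChoice_isSubComPzRing.Build
  (M -> R) smooth_pred smoothfun smooth_subring_closed.
HB.instance Definition _ := [SubZmodule_isSubLmodule of smoothfun by <:].

Definition SmoothFun (f : M -> R) (sf : smooth f) : smoothfun :=
  SmoothFun_ (mem_set sf : smooth_pred f).

Lemma smoothfunP (f : smoothfun) : smooth f.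
Proof. by case: f => f sf; exact: set_mem sf. Qed.

End SmoothFunctions.

Section Tangent.
Context {R : realType} {d : nat} {M : manifold R d}.

(* Tangent vectors at p are the derivations at p of C^oo(M). *)
Definition derivation_at (p : M) (v : smoothfun M -> R) : Prop :=
  scalar v /\ forall f g : smoothfun M, v (f * g) = v f * g p + f p * v g.

Definition derivation_at_pred (p : M) : {pred smoothfun M -> R} :=
  mem [set v | derivation_at p v].

Record tangent (p : M) := Tangent_ {
  tangent_val :> smoothfun M -> R ;
  tangent_subproof : derivation_at_pred p tangent_val }.

HB.instance Definition _ (p : M) := [isSub for @tangent_val p].
HB.instance Definition _ (p : M) := [Choice of tangent p by <:].

Lemma derivation_at_predP (p : M) v :
  v \in derivation_at_pred p <-> derivation_at p v.
Proof. by split=> [/set_mem|dv]; [|exact: mem_set]. Qed.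

Lemma derivation_at_submod_closed (p : M) :
  submod_closed (derivation_at_pred p).
Proof.
split.
  have E0 h : (0 : smoothfun M -> R) h = 0 by [].
  apply/derivation_at_predP; split=> [a f g|f g]; rewrite !E0.
    by rewrite /GRing.scale /= mulr0 addr0.
  by rewrite mul0r mulr0 addr0.
move=> a u v /derivation_at_predP [ul uM] /derivation_at_predP [vl vM].
have EL h : (a *: u + v) h = a * u h + v h by [].
apply/derivation_at_predP; split=> [b f g|f g]; rewrite !EL.
  by rewrite ul vl /= !mulrDr mulrCA addrACA.
by rewrite uM vM !mulrDl !mulrDr addrACA !mulrA [f p * a]mulrC.
Qed.

HB.instance Definition _ (p : M) :=
  GRing.isSubmodClosed.Build R (smoothfun M -> R) (derivation_at_pred p)
    (derivation_at_submod_closed p).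
HB.instance Definition _ (p : M) := GRing.SubChoice_isSubLmodule.Build
  R (smoothfun M -> R) (derivation_at_pred p) (tangent p)
  (derivation_at_submod_closed p).

Definition Tangent (p : M) v (dv : derivation_at p v) : tangent p :=
  Tangent_ (mem_set dv : derivation_at_pred p v).

Lemma tangentP (p : M) (v : tangent p) : derivation_at p v.
Proof. by case: v => v dv; exact: set_mem dv. Qed.

End Tangent.

Section VectorFields.
Context {R : realType} {d : nat} (M : manifold R d).

(* The sections X of TM such that p |-> X_p f is smooth for every smooth f. *)
Record vfield := VField {
  vfield_val :> forall p : M, tangent p ;
  vfield_smooth : forall f : smoothfun M, smooth (fun p => vfield_val p f) }.

HB.instance Definition _ := gen_eqMixin vfield.
HB.instance Definition _ := gen_choiceMixin vfield.

Lemma vfieldP (X Y : vfield) : (forall p, X p = Y p) -> X = Y.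
Proof.
case: X Y => [X sX] [Y sY] /= XY.
have {}XY : X = Y by exact: functional_extensionality_dep.
by subst Y; congr VField; exact: Prop_irrelevance.
Qed.

Definition vderiv (X : vfield) (f : smoothfun M) : smoothfun M :=
  SmoothFun (vfield_smooth X f).

Definition vzero := @VField (fun p => 0) (fun f => @smooth_cst R d M 0).

Definition vopp (X : vfield) := @VField (fun p => - X p)
  (fun f => smoothfunP (- vderiv X f)).

Definition vadd (X Y : vfield) := @VField (fun p => X p + Y p)
  (fun f => smoothfunP (vderiv X f + vderiv Y f)).

Definition vscale (h : smoothfun M) (X : vfield) :=
  @VField (fun p => h p *: X p) (fun f => smoothfunP (h * vderiv X f)).

Let vaddA : associative vadd.
Proof. by move=> X Y Z; apply: vfieldP => p; exact: addrA. Qed.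
Let vaddC : commutative vadd.
Proof. by move=> X Y; apply: vfieldP => p; exact: addrC. Qed.
Let vadd0 : left_id vzero vadd.
Proof. by move=> X; apply: vfieldP => p; exact: add0r. Qed.
Let vaddN : left_inverse vzero vopp vadd.
Proof. by move=> X; apply: vfieldP => p; exact: addNr. Qed.

HB.instance Definition _ :=
  GRing.isZmodule.Build vfield vaddA vaddC vadd0 vaddN.

Let vscaleA h k X : vscale h (vscale k X) = vscale (h * k) X.
Proof. by apply: vfieldP => p; exact: scalerA. Qed.
Let vscale1 : left_id 1 vscale.
Proof. by move=> X; apply: vfieldP => p; exact: scale1r. Qed.
Let vscaleDr : right_distributive vscale +%R.
Proof. by move=> h X Y; apply: vfieldP => p; exact: scalerDr. Qed.
Let vscaleDl X : {morph vscale^~ X : h k / h + k}.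
Proof. by move=> h k; apply: vfieldP => p; exact: scalerDl. Qed.

HB.instance Definition _ := GRing.Zmodule_isLmodule.Build (smoothfun M) vfield
  vscaleA vscale1 vscaleDr vscaleDl.

Lemma smoothfun_eqP (f g : smoothfun M) : (forall p, f p = g p) -> f = g.
Proof. by move=> fg; apply/val_inj/funext. Qed.

Lemma vderiv_linear (X : vfield) a (f g : smoothfun M) :
  vderiv X (a *: f + g) = a *: vderiv X f + vderiv X g.
Proof.
by apply: smoothfun_eqP => p; rewrite /= (tangentP (X p)).1.
Qed.

Lemma vderivM (X : vfield) (f g : smoothfun M) :
  vderiv X (f * g) = vderiv X f * g + f * vderiv X g.
Proof.
by apply: smoothfun_eqP => p; rewrite /= (tangentP (X p)).2.
Qed.

Lemma lie_bracket_derivation (X Y : vfield) (p : M) :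
  derivation_at p (fun f => X p (vderiv Y f) - Y p (vderiv X f)).
Proof.
have XL (Z : vfield) a (f g : smoothfun M) :
  Z p (a *: f + g) = a * Z p f + Z p g by exact: (tangentP (Z p)).1.
have XD (Z : vfield) (f g : smoothfun M) : Z p (f + g) = Z p f + Z p g.
  by rewrite -[f in LHS]scale1r XL mul1r.
have XM (Z : vfield) (f g : smoothfun M) :
  Z p (f * g) = Z p f * g p + f p * Z p g by exact: (tangentP (Z p)).2.
split=> [a f g|f g].
  by rewrite !vderiv_linear !XL /GRing.scale /= mulrBr opprD addrACA.
rewrite !vderivM !XD !XM /=.
ring.
Qed.

Definition lie_bracket (X Y : vfield) : vfield :=
  @VField (fun p => Tangent (lie_bracket_derivation X Y p))
    (fun f => smoothfunP (vderiv X (vderiv Y f) - vderiv Y (vderiv X f))).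

End VectorFields.

Section Tensors.
Context {R : realType} {d : nat} (M : manifold R d).

Record tensor02 := Tensor02 {
  tensor02_val :>
    forall p : M, {bilinear tangent p -> tangent p -> R | *%R & *%R} ;
  tensor02_smooth : forall X Y : vfield M,
    smooth (fun p => tensor02_val p (X p) (Y p)) }.

(* S p u v stands for S_u v. *)
Record tensor12 := Tensor12 {
  tensor12_val :>
    forall p : M, {bilinear tangent p -> tangent p -> tangent p | *:%R & *:%R} ;
  tensor12_smooth : forall (X Y : vfield M) (f : smoothfun M),
    smooth (fun p => tensor12_val p (X p) (Y p) f) }.

Definition apply02 (t : tensor02) (X Y : vfield M) : smoothfun M :=
  SmoothFun (tensor02_smooth t X Y).

Definition apply12 (S : tensor12) (X Y : vfield M) : vfield M :=
  VField (tensor12_smooth S X Y).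

Definition nondegenerate02 (t : tensor02) : Prop :=
  forall (p : M) (u : tangent p), (forall v, t p u v = 0) -> u = 0.

Definition exterior_derivative (w : tensor02) (X Y Z : vfield M) :
    smoothfun M :=
  vderiv X (apply02 w Y Z) - vderiv Y (apply02 w X Z)
  + vderiv Z (apply02 w X Y)
  - apply02 w (lie_bracket X Y) Z + apply02 w (lie_bracket X Z) Y
  - apply02 w (lie_bracket Y Z) X.

Record symplectic (w : tensor02) : Prop := Symplectic {
  symplectic_alternating : forall (p : M) (u : tangent p), w p u u = 0 ;
  symplectic_nondegenerate : nondegenerate02 w ;
  symplectic_closed : forall X Y Z, exterior_derivative w X Y Z = 0 }.

(* The index of the metric is arbitrary. *)
Record pseudo_riemannian (g : tensor02) : Prop := PseudoRiemannian {
  pseudo_riemannian_sym :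
    forall (p : M) (u v : tangent p), g p u v = g p v u ;
  pseudo_riemannian_nondegenerate : nondegenerate02 g }.

End Tensors.

Section Connections.
Context {R : realType} {d : nat} (M : manifold R d).

(* Linear (Koszul) connections; nabla X Y stands for nabla_X Y. Linearity over
   the reals in Y is the Leibniz rule for constant functions. *)
Record connection := Connection {
  connection_val :> vfield M -> vfield M -> vfield M ;
  connectionDl : forall X X' Y,
    connection_val (X + X') Y = connection_val X Y + connection_val X' Y ;
  connectionZl : forall f X Y,
    connection_val (f *: X) Y = f *: connection_val X Y ;
  connectionDr : forall X Y Y',
    connection_val X (Y + Y') = connection_val X Y + connection_val X Y' ;
  connection_leibniz : forall X f Y,
    connection_val X (f *: Y) = vderiv X f *: Y + f *: connection_val X Y }.

Definition torsion_free (D : connection) : Prop :=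
  forall X Y, D X Y - D Y X = lie_bracket X Y.

Definition curvature (D : connection) (X Y Z : vfield M) : vfield M :=
  D X (D Y Z) - D Y (D X Z) - D (lie_bracket X Y) Z.

Definition parallel02 (D : connection) (t : tensor02 M) : Prop :=
  forall X Y Z,
    vderiv X (apply02 t Y Z) - apply02 t (D X Y) Z - apply02 t Y (D X Z) = 0.

Definition parallel12 (D : connection) (S : tensor12 M) : Prop :=
  forall X Y Z,
    D X (apply12 S Y Z) - apply12 S (D X Y) Z - apply12 S Y (D X Z) = 0.

(* For a (1,3)-tensor field given by its action on vector fields. *)
Definition parallel13 (D : connection)
    (T : vfield M -> vfield M -> vfield M -> vfield M) : Prop :=
  forall X Y Z W,
    D X (T Y Z W) - T (D X Y) Z W - T Y (D X Z) W - T Y Z (D X W) = 0.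

Section SubConnection.
Variables (D : connection) (S : tensor12 M).

Definition sub_connection_val X Y := D X Y - apply12 S X Y.

Lemma sub_connectionDl X X' Y : sub_connection_val (X + X') Y =
  sub_connection_val X Y + sub_connection_val X' Y.
Proof.
rewrite /sub_connection_val connectionDl addrACA -opprD.
by congr (_ - _); apply: vfieldP => p; exact: linearDl.
Qed.

Lemma sub_connectionZl f X Y :
  sub_connection_val (f *: X) Y = f *: sub_connection_val X Y.
Proof.
rewrite /sub_connection_val connectionZl scalerBr.
by congr (_ - _); apply: vfieldP => p; exact: linearZl_LR.
Qed.

Lemma sub_connectionDr X Y Y' : sub_connection_val X (Y + Y') =
  sub_connection_val X Y + sub_connection_val X Y'.
Proof.
rewrite /sub_connection_val connectionDr addrACA -opprD.
by congr (_ - _); apply: vfieldP => p; exact: linearDr.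
Qed.

Lemma sub_connection_leibniz X f Y : sub_connection_val X (f *: Y) =
  vderiv X f *: Y + f *: sub_connection_val X Y.
Proof.
rewrite /sub_connection_val connection_leibniz scalerBr addrA.
by congr (_ - _); apply: vfieldP => p; exact: linearZr_LR.
Qed.

Definition sub_connection : connection :=
  Connection sub_connectionDl sub_connectionZl sub_connectionDr
    sub_connection_leibniz.

End SubConnection.

Record fedosov (w : tensor02 M) (D : connection) : Prop := Fedosov {
  fedosov_symplectic : symplectic w ;
  fedosov_torsion_free : torsion_free D ;
  fedosov_parallel : parallel02 D w }.

Record homogeneous_structure (w : tensor02 M) (D : connection)
    (S : tensor12 M) : Prop := HomogeneousStructure {
  homogeneous_curvature : parallel13 (sub_connection D S) (curvature D) ;
  homogeneous_structure_tensor : parallel12 (sub_connection D S) S ;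
  homogeneous_symplectic : parallel02 (sub_connection D S) w }.

(* xi = 0, that is S = 0, is not excluded. *)
Definition linear_type (w : tensor02 M) (S : tensor12 M) : Prop :=
  exists xi : vfield M, forall (p : M) (u v : tangent p),
    S p u v = w p u v *: xi p - w p v (xi p) *: u.

Definition annihilates (S : tensor12 M) (g : tensor02 M) : Prop :=
  forall (p : M) (u v w : tangent p), g p (S p u v) w + g p v (S p u w) = 0.

End Connections.

(* Main.v *)
(** The obstruction is pointwise. Antisymmetry of [w] gives
    [S_xi v = 2 w(xi, v) xi], so [S . g = 0] with both arguments equal to [v]
    yields [4 w(xi, v) g(xi, v) = 0] for every [v]. Where [xi] does not vanish,
    [w(xi, -)] and [g(xi, -)] are nonzero linear forms by nondegeneracy, and a
    product of two nonzero linear forms does not vanish identically. *)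
Require Import Defs.
From HB Require Import structures.
From mathcomp Require Import all_boot all_order all_algebra.
From mathcomp Require Import sesquilinear.
From mathcomp Require Import boolp classical_sets functions reals.
From mathcomp Require Import topology normedtype derive.

Set Implicit Arguments.
Unset Strict Implicit.
Unset Printing Implicit Defensive.
Import Order.TTheory GRing.Theory Num.Theory.
Import numFieldNormedType.Exports.
Local Open Scope classical_set_scope.
Local Open Scope ring_scope.

(** If neither [a] nor [b] is a witness, then [g a = 0] and [f b = 0], so at [a + b] the forms take
    the nonzero values [f a] and [g b]. *)
Lemma linear_form_product_neq0 (R : idomainType) (V : lmodType R)
    (f g : {scalar V}) (a b : V) :
  f a != 0 -> g b != 0 -> exists v, f v * g v != 0.
Proof.
move=> fa gb.
have [ga|ga] := eqVneq (g a) 0; last by exists a; rewrite mulf_neq0.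
have [fb|fb] := eqVneq (f b) 0; last by exists b; rewrite mulf_neq0.
by exists (a + b); rewrite !linearD ga fb addr0 add0r mulf_neq0.
Qed.

Lemma symplectic_antisym (R : realType) (d : nat) (M : manifold R d)
    (w : tensor02 M) (sw : symplectic w) (p : M) (u v : tangent p) :
  w p v u = - w p u v.
Proof.
(* Polarization of the alternating identity. *)
have := symplectic_alternating sw (u + v).
rewrite linearDr !linearDl /= !(symplectic_alternating sw).
by rewrite add0r addr0 => /eqP; rewrite addr_eq0 => /eqP.
Qed.

Lemma nondegenerate02_ex (R : realType) (d : nat) (M : manifold R d)
    (t : tensor02 M) (nt : nondegenerate02 t) (p : M) (u : tangent p) :
  u != 0 -> exists v, t p u v != 0.
Proof.
move=> u0; apply: contrapT => tu0; case/eqP: u0; apply: nt => v.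
by apply/eqP/negPn/negP => tuv; apply: tu0; exists v.
Qed.

Theorem theorem7p2 (R : realType) (d : nat) (M : manifold R d)
    (w : tensor02 M) (nabla : connection M) (S : tensor12 M)
    (fedosov_M : fedosov w nabla)
    (homogeneous_S : homogeneous_structure w nabla S)
    (linear_S : linear_type w S)
    (S_neq0 : exists (p : M) (u v : tangent p), S p u v <> 0) :
  ~ exists g : tensor02 M, pseudo_riemannian g /\ annihilates S g.
Proof.
case=> g [[g_sym g_nd] Sg]; have [xi SE] := linear_S.
have w_sp := fedosov_symplectic fedosov_M.
have [p [u [v Suv]]] := S_neq0.
(* The value of [S] at [p] depends linearly on [xi p], so it would vanish with it. *)
have xi0 : xi p != 0.
  apply/eqP => xi0; apply: Suv.
  by rewrite SE xi0 scaler0 linear0r scale0r subr0.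
have [a wa] := nondegenerate02_ex (symplectic_nondegenerate w_sp) xi0.
have [b gb] := nondegenerate02_ex g_nd xi0.
have [z] := linear_form_product_neq0 wa gb.
case/negP; have := Sg p (xi p) z z.
rewrite [g p z _]g_sym SE (symplectic_antisym w_sp (xi p) z) scaleNr opprK.
(* One factor 2 comes from the two equal terms of [S p (xi p) z], the other from the symmetry of
   [g]; their product 4 is nonzero in [R]. *)
rewrite -scalerDl linearZl_LR /= -!mulr2n mulrnAl -mulrnA => /eqP.
by rewrite mulrn_eq0.
Qed.
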